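(* Let $\bar z\in\mathbb R^n$ be a local minimizer of (P). For $\lambda\in K(\bar z)$, let $\mathrm{Inc}(\lambda)$ denote the condition that $$D^*\mathcal H((\bar z,\lambda),(0,0))(\mu,\nu)\subset D^*F(\bar z,\lambda)(\mu)\times\{-\mu\}+D^*G((\bar z,\lambda),0)(\nu)\qquad\text{for all }\mu\in\mathbb R^m,\ \nu\in\mathbb R^s.$$ Consider the following assumptions: (a) $H_M$ is metrically subregular at $(\bar z,(0,0))$, $\widehat K$ is inner semicompact at $(\bar z,0)$ w.r.t. $\operatorname{dom}\widehat K$, and for each $\lambda\in K(\bar z)$, $\widehat{\mathcal H}$ is metrically subregular at $((\bar z,0,\lambda),(0,0))$ while $\mathrm{Inc}(\lambda)$ holds; (b) $H_M$ is metrically subregular at $(\bar z,(0,0))$, the mapping $(z,w)\rightrightarrows\{(z,\lambda)\mid\lambda\in F(z),\ w\in G(z,\lambda)\}$ is inner semicompact at $(\bar z,0)$ w.r.t. its domain, and for each $\lambda\in K(\bar z)$, the mapping $(z,w,q,\lambda')\rightrightarrows(z-q,\ F(z)-\lambda',\ G(q,\lambda')-w)$ is metrically subregular at $((\bar z,0,\bar z,\lambda),(0,0,0))$; (c) $\mathcal H_M$ is metrically subregular at $((\bar z,\bar\lambda),(0,0,0))$ for some $\bar\lambda\in K(\bar z)$ and $\mathrm{Inc}(\bar\lambda)$ holds; (d) $\mathfrak H_M$ is metrically subregular at $((\bar z,\bar\lambda),((0,0),(0,0,0),0))$ for some $\bar\lambda\in K(\bar z)$. Then each of (a), (b), (c),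 and (d) implies that $\bar z$ is explicitly M-stationary.
   Context: Let $f\colon\mathbb R^n\to\mathbb R$ be locally Lipschitz continuous, let $F\colon\mathbb R^n\rightrightarrows\mathbb R^m$ and $G\colon\mathbb R^n\times\mathbb R^m\rightrightarrows\mathbb R^s$ be set-valued mappings with closed graphs, and let $M\subset\mathbb R^n$ be nonempty and closed. Set $H(z):=\bigcup_{\lambda\in F(z)}G(z,\lambda)$; it is assumed that $\operatorname{gph}H$ is (locally) closed. Problem (P): minimize $f(z)$ over $z\in\mathbb R^n$ subject to $0\in H(z)$, $z\in M$. Put $K(z):=\{\lambda\in F(z)\mid 0\in G(z,\lambda)\}$ and $\widehat K(z,w):=\{\lambda\in F(z)\mid w\in G(z,\lambda)\}$ for $z\in\mathbb R^n$, $w\in\mathbb R^s$. Auxiliary mappings: $H_M(z):=H(z)\times(z-M)$; $\mathcal H(z,\lambda):=(F(z)-\lambda)\times G(z,\lambda)$; $\mathcal H_M(z,\lambda):=\mathcal H(z,\lambda)\times(z-M)$; $\mathfrak H_M(z,\lambda):=\big((z,\lambda)-\operatorname{gph}F\big)\times\big((z,\lambda,0)-\operatorname{gph}G\big)\times(z-M)$; $\widehat{\mathcal H}(z,w,\lambda):=(F(z)-\lambda)\times(G(z,\lambda)-w)$. Variational analysis: products carry the sum of Euclidean norms; $\operatorname{dist}(z,A)=\inf_{a\in A}\|a-z\|$ ($=+\infty$ if $A=\varnothing$). For a set-valued mapping $\Upsilon$, $\operatorname{dom}\Upsilon=\{z\mid\Upsilon(z)\neq\varnothing\}$ and $\Upsilon^{-1}(w)=\{z\mid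 w\in\Upsilon(z)\}$. $\Upsilon$ is metrically subregular at $(\bar z,\bar w)\in\operatorname{gph}\Upsilon$ if there are $\kappa>0$ and a neighborhood $U$ of $\bar z$ with $\operatorname{dist}(z,\Upsilon^{-1}(\bar w))\le\kappa\operatorname{dist}(\bar w,\Upsilon(z))$ for all $z\in U$. $\Upsilon$ is inner semicompact at $\bar z\in\operatorname{dom}\Upsilon$ w.r.t. a set $\Omega$ if for each sequence $\{z_k\}\subset\Omega$ with $z_k\to\bar z$ there are a subsequence $\{z_{k_l}\}$ and a convergent sequence $\{w_l\}$ with $w_l\in\Upsilon(z_{k_l})$ for all $l$. For a closed set $A$ and $\bar z\in A$: $\mathcal T_A(\bar z)$ is the Bouligand tangent cone, $\widehat{\mathcal N}_A(\bar z)$ its polar, and the limiting normal cone $\mathcal N_A(\bar z)$ consists of all limits $\xi=\lim\xi_k$ with $\xi_k\in\widehat{\mathcal N}_A(z_k)$, $z_k\in A$, $z_k\to\bar z$. Limiting subdifferential: $\partial f(\bar z)=\{\xi\mid(\xi,-1)\in\mathcal N_{\operatorname{epi}f}(\bar z,f(\bar z))\}$. Limiting coderivative: $D^*\Upsilon(\bar z,\bar w)(\eta)=\{\xi\mid(\xi,-\eta)\in\mathcal N_{\operatorname{gph}\Upsilon}(\bar z,\bar w)\}$. A feasible point $\bar z$ of (P) is called explicitly M-stationary if there are $\bar\lambda\in K(\bar z)$, $\mu\in\mathbb R^m$, $\nu\in\mathbb R^s$ with $0\in\partial f(\bar z)+D^*F(\bar z,\bar\lambda)(\mu)+\{\xi\in\mathbb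 R^n\mid(\xi,\mu)\in D^*G((\bar z,\bar\lambda),0)(\nu)\}+\mathcal N_M(\bar z)$. *)

(* Defs.v *)
From HB Require Import structures.
From mathcomp Require Import all_boot all_order all_algebra.
From mathcomp Require Import all_classical all_reals all_analysis.
From mathcomp Require Import ring.
Set Implicit Arguments.
Unset Strict Implicit.
Unset Printing Implicit Defensive.
Import Order.TTheory GRing.Theory Num.Theory.
Import numFieldNormedType.Exports.
Local Open Scope classical_set_scope.
Local Open Scope ring_scope.

(* Finite-dimensional spaces with an inner product [edot], which is used for
   polars and normal cones, and a norm [enorm], which is used for distances.
   On a product, [edot] is the sum of the inner products and [enorm] the sum of
   the norms, so [enorm] is in general not the norm induced by [edot]. Nor is it
   the library norm `|x|, which is the maximum norm on row vectors and on
   products; [enorm] is equivalent to it and hence induces the library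
   topology. *)
HB.mixin Record NormedModule_isEuclidean (R : realType) V
    of NormedModule R V := {
  edot : V -> V -> R ;
  enorm : V -> R ;
  edotC : forall x y, edot x y = edot y x ;
  edotDl : forall x y z, edot (x + y) z = edot x z + edot y z ;
  edotZl : forall a x y, edot (a *: x) y = a * edot x y ;
  edotxx_ge0 : forall x, 0 <= edot x x ;
  edotxx_eq0 : forall x, edot x x = 0 -> x = 0 ;
  ler_enormD : forall x y, enorm (x + y) <= enorm x + enorm y ;
  enormZ : forall a x, enorm (a *: x) = `|a| * enorm x ;
  ler_norm_enorm : forall x, `|x| <= enorm x ;
  ler_enorm_norm : exists c : R, forall x, enorm x <= c * `|x| ;
  ler_edot_enorm : forall x y, `|edot x y| <= enorm x * enorm y ;
  compact_norm_le : forall r : R, compact [set x : V | `|x| <= r]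
}.

#[short(type="euclideanType")]
HB.structure Definition Euclidean (R : realType) :=
  {V of NormedModule_isEuclidean R V & NormedModule R V}.

Section scalar.
Variable R : realType.

Let R_compact (r : R) : compact [set x : R^o | `|x| <= r].
Proof.
have -> : [set x : R^o | `|x| <= r] = [set` `[- r, r]].
  by apply/seteqP; split=> x /=; rewrite in_itv /= ler_norml.
exact: segment_compact.
Qed.

Let R_sqr_eq0 (x : R^o) : x * x = 0 :> R -> x = 0.
Proof. by move/eqP; rewrite mulf_eq0 orbb => /eqP. Qed.

Let R_norm_le : exists c : R, forall x : R^o, `|x| <= c * `|x|.
Proof. by exists 1 => x; rewrite mul1r. Qed.

Let R_ler_normM (x y : R^o) : `|x * y : R| <= `|x| * `|y|.
Proof. by rewrite normrM. Qed.

HB.instance Definition _ := @NormedModule_isEuclidean.Build R R^o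
  (fun x y : R => x * y) (fun x : R => `|x|)
  (fun x y => mulrC x y) (fun x y z => mulrDl x y z)
  (fun a x y => esym (mulrA a x y)) (fun x => sqr_ge0 x) R_sqr_eq0
  (fun x y => ler_normD x y) (fun a x => normrM a x) (fun x => lexx `|x|)
  R_norm_le R_ler_normM R_compact.

End scalar.

Section row_vectors.
Variables (R : realType) (n : nat).
Implicit Types x y z : 'rV[R]_n.

Definition rVdot x y : R := \sum_i x 0 i * y 0 i.
Definition rVnorm x : R := Num.sqrt (\sum_i x 0 i ^+ 2).

Let rVnormE x : rVnorm x = Num.sqrt (rVdot x x).
Proof. by congr Num.sqrt; apply: eq_bigr => i _; rewrite expr2. Qed.

Let rVdotC x y : rVdot x y = rVdot y x.
Proof. by apply: eq_bigr => i _; rewrite mulrC. Qed.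

Let rVdotDl x y z : rVdot (x + y) z = rVdot x z + rVdot y z.
Proof. by rewrite -big_split; apply: eq_bigr => i _; rewrite mxE mulrDl. Qed.

Let rVdotZl a x y : rVdot (a *: x) y = a * rVdot x y.
Proof. by rewrite mulr_sumr; apply: eq_bigr => i _; rewrite mxE mulrA. Qed.

Let rVdot_ge0 x : 0 <= rVdot x x.
Proof. by apply: sumr_ge0 => i _; rewrite -expr2 sqr_ge0. Qed.

Let rVdot_eq0 x : rVdot x x = 0 -> x = 0.
Proof.
move=> /eqP; rewrite psumr_eq0; last by move=> i _; rewrite -expr2 sqr_ge0.
move=> /allP x0; apply/rowP => i; rewrite mxE; apply/eqP.
by rewrite -sqrf_eq0 expr2; apply: x0; rewrite mem_index_enum.
Qed.

Let rVnorm_sqr x : rVnorm x ^+ 2 = rVdot x x.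
Proof. by rewrite rVnormE sqr_sqrtr. Qed.

Let rVdot_CS x y : rVdot x y ^+ 2 <= rVdot x x * rVdot y y.
Proof.
have [y0|yN0] := eqVneq (rVdot y y) 0.
  have -> : y = 0 by exact: rVdot_eq0.
  rewrite rVdotC -[0 in leLHS](scale0r (0 : 'rV[R]_n)) rVdotZl mul0r expr0n /=.
  by rewrite mulr_ge0.
have y_gt0 : 0 < rVdot y y by rewrite lt_def yN0 rVdot_ge0.
have := rVdot_ge0 (rVdot y y *: x + (- rVdot x y) *: y).
rewrite rVdotDl !rVdotZl ![rVdot _ (_ + _)]rVdotC !rVdotDl !rVdotZl.
rewrite (rVdotC y x) => h.
rewrite -subr_ge0 -(pmulr_rge0 _ y_gt0); apply: le_trans h _.
by rewrite le_eqVlt; apply/orP; left; apply/eqP; ring.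
Qed.

Let rVdot_le x y : `|rVdot x y| <= rVnorm x * rVnorm y.
Proof.
by rewrite !rVnormE -sqrtrM // -sqrtr_sqr ler_sqrt ?mulr_ge0.
Qed.

Let rVnormD x y : rVnorm (x + y) <= rVnorm x + rVnorm y.
Proof.
rewrite -(@ler_pXn2r _ 2) ?nnegrE ?addr_ge0 ?sqrtr_ge0 //.
rewrite sqrrD !rVnorm_sqr rVdotDl !(rVdotC _ (x + y)) !rVdotDl.
rewrite (rVdotC y x) [leLHS](_ : _ = rVdot x x + rVdot x y *+ 2 + rVdot y y).
  2: by ring.
rewrite lerD2r lerD2l lerMn2r /=.
by rewrite (le_trans (ler_norm _)).
Qed.

Let rVnormZ a x : rVnorm (a *: x) = `|a| * rVnorm x.
Proof.
rewrite !rVnormE rVdotZl rVdotC rVdotZl mulrA -expr2 sqrtrM ?sqr_ge0 //.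
by rewrite sqrtr_sqr.
Qed.

Let norm_rVnorm x : `|x| <= rVnorm x.
Proof.
rewrite /Num.norm /= mx_normrE; apply/bigmax_leP; split=> [|[i j] _ /=].
  exact: sqrtr_ge0.
rewrite (ord1 i) -sqrtr_sqr ler_sqrt; last first.
  by apply: sumr_ge0 => k _; exact: sqr_ge0.
by rewrite (bigD1 j) //= lerDl; apply: sumr_ge0 => k _; exact: sqr_ge0.
Qed.

Let rVnorm_norm : exists c : R, forall x, rVnorm x <= c * `|x|.
Proof.
exists (Num.sqrt n%:R) => x.
rewrite -[X in _ * X]ger0_norm // -[X in _ * X]sqrtr_sqr -sqrtrM //.
rewrite ler_sqrt ?mulr_ge0 ?sqr_ge0 //.
apply: (@le_trans _ _ (\sum_(i < n) `|x| ^+ 2)).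
  apply: ler_sum => i _; rewrite -real_normK ?num_real // lerXn2r ?nnegrE //.
  rewrite [leRHS]/Num.norm /= mx_normrE.
  by apply: (le_bigmax _ (fun i : 'I_1 * 'I_n => `|x i.1 i.2|) (0, i)).
by rewrite sumr_const card_ord mulr_natl.
Qed.

Let rV_norm_compact (r : R) : compact [set x : 'rV[R]_n | `|x| <= r].
Proof.
apply: bounded_closed_compact.
  by exists r; split=> [|M rM x /= xr]; [exact: num_real|exact: le_trans (ltW rM)].
apply: (preimage_closed (f := fun x : 'rV[R]_n => `|x|) (D := [set y | y <= r])).
  by move=> x _; exact: norm_continuous.
exact: closed_le.
Qed.

HB.instance Definition _ := @NormedModule_isEuclidean.Build R 'rV[R]_n
  rVdot rVnorm rVdotC rVdotDl rVdotZl rVdot_ge0 rVdot_eq0 rVnormD rVnormZ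
  norm_rVnorm rVnorm_norm rVdot_le rV_norm_compact.

End row_vectors.

Section products.
Variables (R : realType) (V W : euclideanType R).
Implicit Types p q r : V * W.

Definition proddot p q : R := edot p.1 q.1 + edot p.2 q.2.
Definition prodnorm p : R := enorm p.1 + enorm p.2.

Let enorm_ge0 (U : euclideanType R) (x : U) : 0 <= enorm x.
Proof. exact: le_trans (normr_ge0 x) (ler_norm_enorm x). Qed.

Let proddotC p q : proddot p q = proddot q p.
Proof. by rewrite /proddot edotC (edotC p.2). Qed.

Let proddotDl p q r : proddot (p + q) r = proddot p r + proddot q r.
Proof. by rewrite /proddot !edotDl addrACA. Qed.

Let proddotZl a p q : proddot (a *: p) q = a * proddot p q.
Proof. by rewrite /proddot !edotZl mulrDr. Qed.

Let proddot_ge0 p : 0 <= proddot p p.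
Proof. by rewrite addr_ge0 ?edotxx_ge0. Qed.

Let proddot_eq0 p : proddot p p = 0 -> p = 0.
Proof.
case: p => x y /eqP; rewrite paddr_eq0 ?edotxx_ge0 //= => /andP[/eqP x0 /eqP y0].
by rewrite (edotxx_eq0 _ x0) (edotxx_eq0 _ y0).
Qed.

Let prodnormD p q : prodnorm (p + q) <= prodnorm p + prodnorm q.
Proof. by rewrite /prodnorm addrACA lerD ?ler_enormD. Qed.

Let prodnormZ a p : prodnorm (a *: p) = `|a| * prodnorm p.
Proof. by rewrite /prodnorm !enormZ mulrDr. Qed.

Let norm_prodnorm p : `|p| <= prodnorm p.
Proof.
rewrite prod_normE ge_max; apply/andP; split.
  by rewrite (le_trans (ler_norm_enorm _)) // lerDl.
by rewrite (le_trans (ler_norm_enorm _)) // lerDr.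
Qed.

Let prodnorm_norm : exists c : R, forall p, prodnorm p <= c * `|p|.
Proof.
have [a ha] := @ler_enorm_norm R V; have [b hb] := @ler_enorm_norm R W.
exists (`|a| + `|b|) => p; rewrite prod_normE mulrDl lerD //.
- rewrite (le_trans (ha _)) // (le_trans (ler_norm _)) // normrM normr_id.
  by rewrite ler_wpM2l // le_max lexx.
- rewrite (le_trans (hb _)) // (le_trans (ler_norm _)) // normrM normr_id.
  by rewrite ler_wpM2l // le_max lexx orbT.
Qed.

Let proddot_le p q : `|proddot p q| <= prodnorm p * prodnorm q.
Proof.
rewrite (le_trans (ler_normD _ _)) //.
rewrite (le_trans (lerD (ler_edot_enorm _ _) (ler_edot_enorm _ _))) //.
by rewrite /prodnorm mulrDl !mulrDr lerD // ?lerDl ?lerDr mulr_ge0.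
Qed.

Let prod_norm_compact (r : R) : compact [set p : V * W | `|p| <= r].
Proof.
have -> : [set p : V * W | `|p| <= r] =
    [set x : V | `|x| <= r] `*` [set y : W | `|y| <= r].
  by apply/seteqP; split=> p /=; rewrite prod_normE ge_max => /andP.
by apply: compact_setX; exact: compact_norm_le.
Qed.

HB.instance Definition _ := @NormedModule_isEuclidean.Build R (V * W)%type
  proddot prodnorm proddotC proddotDl proddotZl proddot_ge0 proddot_eq0
  prodnormD prodnormZ norm_prodnorm prodnorm_norm proddot_le prod_norm_compact.

End products.

Section set_valued.
Variables (R : realType) (V W : euclideanType R).

Definition gph (Y : V -> set W) : set (V * W) := [set p | Y p.1 p.2].
Definition svdom (Y : V -> set W) : set V := [set z | Y z !=set0].
Definition svinv (Y : V -> set W) (w : W) : set V := [set z | Y z w].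

Definition eucl_dist (U : euclideanType R) (z : U) (A : set U) : \bar R :=
  ereal_inf [set (enorm (a - z))%:E | a in A].

Definition minkowski_sum (U : euclideanType R) (A B : set U) : set U :=
  [set a + b | a in A & b in B].

Definition metrically_subregular (Y : V -> set W) (zb : V) (wb : W) :=
  Y zb wb /\
  exists2 kappa : R, 0 < kappa &
    \forall z \near zb,
      (eucl_dist z (svinv Y wb) <= kappa%:E * eucl_dist wb (Y z))%E.

Definition inner_semicompact (Y : V -> set W) (zb : V) (Omega : set V) :=
  svdom Y zb /\
  forall z : nat -> V, (forall k, Omega (z k)) -> z @ \oo --> zb ->
    exists (phi : nat -> nat) (w : nat -> W) (wb : W),
      [/\ {homo phi : i j / (i < j)%N}, w @ \oo --> wb &
          forall l, Y (z (phi l)) (w l)].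

Definition locally_closed (A : set V) :=
  forall x, A x -> exists U : set V, [/\ nbhs x U, closed U & closed (A `&` U)].

Definition locally_lipschitz (f : V -> R) :=
  forall z : V, exists L : R, \forall x \near z & y \near z,
    `|f x - f y| <= L * enorm (x - y).

End set_valued.

Section normals.
Variable R : realType.

Definition tangent_cone (V : euclideanType R) (A : set V) (zb : V) : set V :=
  [set d | exists (t : nat -> R) (dk : nat -> V),
    [/\ forall k, 0 < t k, t @ \oo --> (0 : R), dk @ \oo --> d &
        forall k, A (zb + t k *: dk k)]].

Definition polar (V : euclideanType R) (A : set V) : set V :=
  [set xi | forall d, A d -> edot xi d <= 0].

Definition regular_normal_cone (V : euclideanType R) (A : set V) (zb : V) :=
  polar (tangent_cone A zb).

Definition limiting_normal_cone (V : euclideanType R) (A : set V) (zb : V) :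
    set V :=
  [set xi | exists (z xik : nat -> V),
    [/\ forall k, A (z k), z @ \oo --> zb, xik @ \oo --> xi &
        forall k, regular_normal_cone A (z k) (xik k)]].

Definition epi (V : euclideanType R) (f : V -> R) : set (V * R^o) :=
  [set p | f p.1 <= p.2].

Definition limiting_subdifferential (V : euclideanType R) (f : V -> R)
    (zb : V) : set V :=
  [set xi | limiting_normal_cone (epi f) (zb, f zb : R^o) (xi, -1 : R^o)].

Definition coderivative (V W : euclideanType R) (Y : V -> set W)
    (zb : V) (wb : W) (eta : W) : set V :=
  [set xi | limiting_normal_cone (gph Y) (zb, wb) (xi, - eta)].

End normals.

Section problem.
Variables (R : realType) (n m s : nat).
Local Notation Z := ('rV[R]_n).
Local Notation L := ('rV[R]_m).
Local Notation S := ('rV[R]_s).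
Variables (f : Z -> R) (F : Z -> set L) (G : Z * L -> set S) (M : set Z).

Definition H_map (z : Z) : set S := \bigcup_(l in F z) G (z, l).

Definition feasible (z : Z) := H_map z 0 /\ M z.

Definition local_minimizer (zb : Z) :=
  feasible zb /\ \forall z \near zb, feasible z -> f zb <= f z.

Definition K_map (z : Z) : set L := [set l | F z l /\ G (z, l) 0].

(* HM_map, Khat_map, calH_map, calHM_map, frakHM_map and calHhat_map are H_M,
   \hat K, \mathcal H, \mathcal H_M, \mathfrak H_M and \hat{\mathcal H}.
   Differences of a set and a point are Minkowski differences; triples are
   nested to the left. *)
Definition HM_map (z : Z) : set (S * Z) :=
  H_map z `*` [set z - x | x in M].

Definition Khat_map (p : Z * S) : set L :=
  [set l | F p.1 l /\ G (p.1, l) p.2].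

Definition calH_map (p : Z * L) : set (L * S) :=
  [set y - p.2 | y in F p.1] `*` G p.

Definition calHM_map (p : Z * L) : set (L * S * Z) :=
  calH_map p `*` [set p.1 - x | x in M].

Definition frakHM_map (p : Z * L) : set ((Z * L) * (Z * L * S) * Z) :=
  [set p - q | q in gph F] `*` [set (p, 0 : S) - q | q in gph G]
  `*` [set p.1 - x | x in M].

Definition calHhat_map (p : Z * S * L) : set (L * S) :=
  let: (z, w, l) := p in
  [set y - l | y in F z] `*` [set y - w | y in G (z, l)].

Definition Kpair_map (p : Z * S) : set (Z * L) :=
  [set q | [/\ q.1 = p.1, F p.1 q.2 & G (p.1, q.2) p.2]].

Definition Hsplit_map (p : Z * S * Z * L) : set (Z * L * S) :=
  let: (z, w, q, l) := p in
  [set z - q] `*` [set y - l | y in F z] `*` [set y - w | y in G (q, l)].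

Definition coderivative_inclusion (zb : Z) (l : L) :=
  forall (mu : L) (nu : S),
    coderivative calH_map (zb, l) (0, 0) (mu, nu) `<=`
    minkowski_sum (coderivative F zb l mu `*` [set - mu])
                  (coderivative G (zb, l) 0 nu).

Definition explicitly_M_stationary (zb : Z) :=
  feasible zb /\
  exists (l : L) (mu : L) (nu : S), K_map zb l /\
    minkowski_sum
      (minkowski_sum
        (minkowski_sum (limiting_subdifferential f zb) (coderivative F zb l mu))
        [set xi | coderivative G (zb, l) 0 nu (xi, mu)])
      (limiting_normal_cone M zb) 0.

End problem.

(* Main.v *)
Require Import Defs.
From HB Require Import structures.
From mathcomp Require Import all_boot all_order all_algebra.
From mathcomp Require Import all_classical all_reals all_analysis.
From mathcomp Require Import ring lra.
Import Order.TTheory GRing.Theory Num.Theory.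
Import numFieldNormedType.Exports.
Local Open Scope classical_set_scope.
Local Open Scope ring_scope.

(* In each case the subregularity hypotheses show that every z near zb lies
   within C r of a feasible point, where r is the residual of z; since f is
   locally Lipschitz, zb then minimizes f + C' r locally. Giving each closed set
   involved (the epigraph of f, M, and either gph calH or gph F x gph G) its own
   variable turns this into
     <l, yb> <= <l, y> + C' |e - y|  for e in a subspace E, y in a closed set D.
   Minimizing <l, y> + k |e - y|^2 + |y - yb|^2 over E x D and letting k tend to
   infinity yields eta in N_D(yb) with eta + l orthogonal to E, and N_D(yb) is
   contained in the product of the normal cones of the factors.
   In (a) and (b) the residual of H_M does not depend on lambda, so the
   subregularity of H_M composes with that of calHhat or Hsplit at an arbitrary
   single point of K(zb). *)

(** * Inner product and norm estimates in Euclidean spaces *)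

Section euclidean_theory.
Set Implicit Arguments.
Unset Strict Implicit.
Context {R : realType} {V : euclideanType R}.
Implicit Types x y z : V.

Lemma edotDr x y z : edot x (y + z) = edot x y + edot x z.
Proof. by rewrite edotC edotDl !(edotC _ x). Qed.

Lemma edotZr (a : R) x y : edot x (a *: y) = a * edot x y.
Proof. by rewrite edotC edotZl edotC. Qed.

Lemma edotNl x y : edot (- x) y = - edot x y.
Proof. by rewrite -scaleN1r edotZl mulN1r. Qed.

Lemma edotNr x y : edot x (- y) = - edot x y.
Proof. by rewrite edotC edotNl edotC. Qed.

Lemma edotBl x y z : edot (x - y) z = edot x z - edot y z.
Proof. by rewrite edotDl edotNl. Qed.

Lemma edotBr x y z : edot x (y - z) = edot x y - edot x z.
Proof. by rewrite edotDr edotNr. Qed.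

Lemma edot0l x : edot 0 x = 0.
Proof. by rewrite -(scale0r 0) edotZl mul0r. Qed.

Lemma edot0r x : edot x 0 = 0.
Proof. by rewrite edotC edot0l. Qed.

Lemma edot_eq0 x : (forall y, edot x y = 0) -> x = 0.
Proof. by move=> x0; apply: edotxx_eq0. Qed.

Lemma enorm_ge0 x : 0 <= enorm x.
Proof. exact: le_trans (normr_ge0 x) (ler_norm_enorm x). Qed.

Lemma enorm0 : enorm (0 : V) = 0.
Proof. by rewrite -(scale0r 0) enormZ normr0 mul0r. Qed.

Lemma enormN x : enorm (- x) = enorm x.
Proof. by rewrite -scaleN1r enormZ normrN1 mul1r. Qed.

Lemma enormB x y : enorm (x - y) = enorm (y - x).
Proof. by rewrite -enormN opprB. Qed.

Lemma enorm_triangle y x z : enorm (x - z) <= enorm (x - y) + enorm (y - z).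
Proof. by rewrite (le_trans _ (ler_enormD _ _)) // addrA subrK. Qed.

Lemma enorm_bound : exists2 c : R, 0 < c & forall x, enorm x <= c * `|x|.
Proof.
have [c ec] := @ler_enorm_norm R V.
exists (`|c| + 1) => [|x]; first by rewrite ltr_wpDl.
rewrite (le_trans (ec x)) // ler_wpM2r // (le_trans (ler_norm c)) //.
by rewrite lerDl.
Qed.

Lemma edot_bound :
  exists2 c : R, 0 < c & forall x y, `|edot x y| <= c * (`|x| * `|y|).
Proof.
have [c c0 ec] := enorm_bound; exists (c * c) => [|x y]; first exact: mulr_gt0.
rewrite (le_trans (ler_edot_enorm _ _)) // mulrACA.
by rewrite ler_pM ?enorm_ge0.
Qed.

(** Bilinearity splits the error into [edot (f t - a) (g t) + edot a (g t - b)], and each summand is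
    controlled by a product of norms one factor of which vanishes. *)
Lemma edot_cvg (T : Type) (F : set_system T) (FF : Filter F) (f g : T -> V)
    (a b : V) : f @ F --> a -> g @ F --> b ->
  edot (f t) (g t) @[t --> F] --> edot a b.
Proof.
move=> fa gb; have [c c0 ec] := edot_bound.
have sq (h : T -> R) (k : T -> R) : (forall t, `|h t| <= k t) ->
    k @ F --> (0 : R) -> h @ F --> (0 : R).
  move=> hk k0; apply: norm_cvg0; apply: (squeeze_cvgr (f := cst 0) _ _ k0).
    by apply: nearW => t; rewrite normr_ge0 hk.
  exact: cvg_cst.
have fa0 : `|f t - a| @[t --> F] --> (0 : R).
  by apply/norm_cvg0P; apply/subr_cvg0.
have gb0 : `|g t - b| @[t --> F] --> (0 : R).
  by apply/norm_cvg0P; apply/subr_cvg0.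
apply/subr_cvg0.
have -> : (fun t => edot (f t) (g t) - edot a b) =
    (fun t => edot (f t - a) (g t) + edot a (g t - b)).
  by apply/funext => t; rewrite edotBl edotBr; ring.
rewrite -[X in _ --> X]addr0; apply: cvgD.
- apply: (sq _ (fun t => c * (`|f t - a| * `|g t|))) => [t|]; first exact: ec.
  rewrite -(mulr0 c) -(mul0r `|b|).
  apply: cvgM; first exact: cvg_cst.
  apply: cvgM => //; exact: cvg_norm.
- apply: (sq _ (fun t => c * (`|a| * `|g t - b|))) => [t|]; first exact: ec.
  rewrite -(mulr0 c) -(mulr0 `|a|).
  apply: cvgM; first exact: cvg_cst.
  apply: cvgM => //; exact: cvg_cst.
Qed.

(** By compactness [edot x x] attains a positive minimum on the unit sphere, and both sides are
    homogeneous of degree two. This converts bounds on quadratic penalty terms into bounds on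
    norms. *)
Lemma norm_sqr_le_edot :
  exists2 c : R, 0 < c & forall x, `|x| ^+ 2 <= c * edot x x.
Proof.
(* An empty unit sphere means that the space is trivial, and then any constant works. *)
have [[x0 x01]|noS] := pselect ([set x : V | `|x| = 1] !=set0); last first.
  exists 1 => // x; have [->|xN0] := eqVneq x 0.
    by rewrite normr0 expr0n /= edot0l mulr0.
  exfalso; apply: noS; exists (`|x|^-1 *: x).
  by rewrite /= normrZ normfV normr_id mulVf ?normr_eq0.
have cS : compact [set x : V | `|x| = 1].
  have -> : [set x : V | `|x| = 1] =
      [set x : V | `|x| <= 1] `&` [set x : V | `|x| = 1].
    by apply/seteqP; split=> x /=; [move=> ->|case].
  apply: compact_closedI; first exact: compact_norm_le.
  apply: (preimage_closed (f := fun x : V => `|x|) (D := [set r | r = 1])).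
    by move=> x _; exact: norm_continuous.
  exact: closed_eq.
have cE : {within [set x : V | `|x| = 1], continuous (fun x : V => edot x x)}.
  by apply: continuous_subspaceT => x; apply: edot_cvg; exact: cvg_id.
have [z zS zmin] := compact_EVT_min (ex_intro _ x0 x01) cS cE.
have z0 : 0 < edot z z.
  rewrite lt_def edotxx_ge0 andbT; apply/eqP => /edotxx_eq0 z0.
  by move: zS; rewrite inE /= z0 normr0 => /eqP; rewrite eq_sym oner_eq0.
exists (edot z z)^-1 => [|x]; first by rewrite invr_gt0.
have [->|xN0] := eqVneq x 0; first by rewrite normr0 expr0n /= edot0l mulr0.
have nx0 : 0 < `|x| by rewrite normr_gt0.
have /zmin : (`|x|^-1 *: x) \in [set x : V | `|x| = 1].
  by rewrite inE /= normrZ normfV normr_id mulVf ?normr_eq0.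
rewrite edotZl edotZr mulrA -invfM -expr2 ler_pdivlMl ?exprn_gt0 // => h.
by rewrite ler_pdivlMl // mulrC.
Qed.

End euclidean_theory.

(** * Criteria for regular and limiting normals *)

Section normal_cones.
Set Implicit Arguments.
Unset Strict Implicit.
Context {R : realType} {V : euclideanType R}.
Implicit Types (A D E : set V).

Lemma limiting_normal_approx A (a xi : V) :
  (forall e : R, 0 < e -> exists y eta : V,
    [/\ A y, `|y - a| < e, `|eta - xi| < e & regular_normal_cone A y eta]) ->
  limiting_normal_cone A a xi.
Proof.
move=> h; have /choice[p hp] (k : nat) : exists p : V * V,
    [/\ A p.1, `|p.1 - a| < harmonic k, `|p.2 - xi| < harmonic k &
        regular_normal_cone A p.1 p.2].
  have [y [eta he]] := h _ (harmonic_gt0 k).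
  by exists (y, eta).
have cv (u : nat -> V) (b : V) :
    (forall k, `|u k - b| < harmonic k) -> u @ \oo --> b.
  move=> ub; apply/subr_cvg0; apply: norm_cvg0.
  apply: (squeeze_cvgr (f := cst 0) _ _ cvg_harmonic).
    by apply: nearW => k; rewrite normr_ge0 ltW.
  exact: cvg_cst.
exists (fun k => (p k).1), (fun k => (p k).2); split.
- by move=> k; case: (hp k).
- by apply: cv => k; case: (hp k).
- by apply: cv => k; case: (hp k).
- by move=> k; case: (hp k).
Qed.

(** First-order optimality: if [g] is the gradient at a local minimizer over [A] and [c] bounds the
    quadratic remainder, dividing by the step [t k] along a tangent sequence makes the remainder
    vanish in the limit. *)
Lemma regular_normal_quadratic A (y0 g : V) (c del : R) :
  0 < del ->
  (forall y, A y -> `|y - y0| < del ->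
    0 <= edot g (y - y0) + c * edot (y - y0) (y - y0)) ->
  regular_normal_cone A y0 (- g).
Proof.
move=> del0 h d [t [dk [t_gt0 t0 dkd Ay]]]; rewrite edotNl oppr_le0.
have tdk0 : t k *: dk k @[k --> \oo] --> (0 : V).
  by rewrite -(scale0r d); exact: cvgZ.
have lim : edot g (dk k) + c * (t k * edot (dk k) (dk k)) @[k --> \oo]
    --> edot g d.
  rewrite -[X in _ --> X]addr0 -(mulr0 c) -(mul0r (edot d d)).
  apply: cvgD; first by apply: edot_cvg => //; exact: cvg_cst.
  apply: cvgM; first exact: cvg_cst.
  by apply: cvgM => //; exact: edot_cvg.
apply: (cvgr_to_ge lim); near=> k.
have yK : y0 + t k *: dk k - y0 = t k *: dk k by rewrite addrC addKr.
have tdk_lt : `|t k *: dk k| < del.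
  near: k; have /cvgrPdist_lt/(_ _ del0) := tdk0.
  by apply: filterS => k; rewrite sub0r normrN.
have := h _ (Ay k); rewrite yK => /(_ tdk_lt).
rewrite edotZl !edotZr => tge.
by rewrite -(pmulr_rge0 _ (t_gt0 k)) mulrDr (mulrCA (t k) c).
Unshelve. all: by end_near. Qed.

Lemma tangent_cone_subspace E (e u : V) :
  (forall a v w, E v -> E w -> E (a *: v + w)) -> E e -> E u ->
  tangent_cone E e u.
Proof.
move=> Elin Ee Eu; exists harmonic, (fun=> u); split.
- by move=> k; exact: harmonic_gt0.
- exact: cvg_harmonic.
- exact: cvg_cst.
- by move=> k; rewrite addrC; exact: Elin.
Qed.

End normal_cones.

(** * A multiplier rule for a subspace and a closed set *)

Section multiplier.
Set Implicit Arguments.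
Unset Strict Implicit.
Context {R : realType} {Y : euclideanType R}.
Variables (E D : set Y) (l yb : Y).
Hypotheses (E_closed : closed E) (D_closed : closed D).
Hypothesis E_lin : forall a v w, E v -> E w -> E (a *: v + w).
Hypotheses (Eyb : E yb) (Dyb : D yb).

(** The term with [kap] forces the two copies of the variable together; the last term pulls the
    minimizers to [yb], which need not be a strict minimizer. *)
Let penalty (kap : R) (p : Y * Y) : R :=
  edot l p.2 + kap * edot (p.1 - p.2) (p.1 - p.2) + edot (p.2 - yb) (p.2 - yb).

Let penalty_minimum (kap del : R) : 0 < del ->
  exists p : Y * Y, [/\ E p.1, D p.2, `|p.1 - yb| <= del, `|p.2 - yb| <= del &
    forall q, E q.1 -> D q.2 -> `|q.1 - yb| <= del -> `|q.2 - yb| <= del ->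
      penalty kap p <= penalty kap q].
Proof.
move=> del0.
have ball_compact : compact [set y : Y | `|y - yb| <= del].
  have -> : [set y : Y | `|y - yb| <= del] =
      [set x + yb | x in [set x : Y | `|x| <= del]].
    apply/seteqP; split=> [y /= yd|_ [x /= xd <-] /=]; last by rewrite addrK.
    by exists (y - yb); rewrite //= subrK.
  apply: continuous_compact; last exact: compact_norm_le.
  apply: continuous_subspaceT => x.
  by apply: cvgD; [exact: cvg_id|exact: cvg_cst].
set K := ([set y | `|y - yb| <= del] `&` E) `*`
         ([set y | `|y - yb| <= del] `&` D).
have K_compact : compact K.
  by apply: compact_setX; exact: compact_closedI.
have K0 : K !=set0.
  by exists (yb, yb); do !split => //=; rewrite subrr normr0 ltW.
have penalty_cont : {within K, continuous (penalty kap)}.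
  apply: continuous_subspaceT => p.
  have c1 : (fun q : Y * Y => q.1) @ p --> p.1 by exact: cvg_fst.
  have c2 : (fun q : Y * Y => q.2) @ p --> p.2 by exact: cvg_snd.
  apply: cvgD; first apply: cvgD.
  - by apply: edot_cvg => //; exact: cvg_cst.
  - apply: cvgM; first exact: cvg_cst.
    by apply: edot_cvg; apply: cvgB.
  - by apply: edot_cvg; apply: cvgB => //; exact: cvg_cst.
have [p] := compact_EVT_min K0 K_compact penalty_cont.
rewrite inE => -[[pe Ep] [pd Dp]] pmin.
by exists p; split=> // q *; apply: pmin; rewrite inE.
Qed.

Variables (C del : R).
Hypotheses (C_ge0 : 0 <= C) (del_gt0 : 0 < del).
Hypothesis yb_min : forall e y, E e -> D y -> `|e - yb| < del ->
  `|y - yb| < del -> edot l yb <= edot l y + C * enorm (e - y).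

(* Comparing a minimizer of [penalty kap] with [(yb, yb)] gives
   [kap * |e - y|^2 <= C * |e - y|], so that [kap * |e - y|], and with it the
   multiplier, stays bounded as [kap] grows. *)
Let approximate_multiplier : exists B : R, forall eps : R, 0 < eps ->
  exists y eta : Y, [/\ D y, `|y - yb| < eps, `|eta| <= B,
    regular_normal_cone D y eta &
    forall e, E e -> edot (eta + l) e = - 2 * edot (y - yb) e].
Proof.
have [c1 c1_gt0 enorm_le] := @enorm_bound R Y.
have [c2 c2_gt0 norm_le] := @norm_sqr_le_edot R Y.
pose B := c2 * (C * c1).
have B_ge0 : 0 <= B by rewrite !mulr_ge0 // ltW.
(* The multiplier will be minus the gradient [l - 2 kap (e - y) + 2 (y - yb)], whose terms have
   norms at most [|l|], [2 B] and [2 del]. *)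
exists (2 * B + `|l| + 2 * del) => eps eps_gt0.
(* With [e - y] and [y - yb] both shorter than [r <= del / 4], the points [e] and [y] lie strictly
   inside the ball of radius [del / 2], so the ball constraint is inactive. *)
pose r := Num.min eps (del / 4).
have r_gt0 : 0 < r by rewrite lt_min eps_gt0 divr_gt0.
have r_eps : r <= eps by rewrite ge_min lexx.
have r_del : r <= del / 4 by rewrite ge_min lexx orbT.
(* The first summand turns [kap * |y - yb|^2 <= B^2] into [|y - yb| < r], the second turns
   [kap * |e - y| <= B] into [|e - y| < r]; the last one makes both strict. *)
pose kap := B ^+ 2 / r ^+ 2 + B / r + 1.
have Br_ge0 : 0 <= B / r by exact: divr_ge0 B_ge0 (ltW r_gt0).
have Br2_ge0 : 0 <= B ^+ 2 / r ^+ 2.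
  exact: divr_ge0 (sqr_ge0 _) (sqr_ge0 _).
have kap_gt0 : 0 < kap by rewrite ltr_wpDl // addr_ge0.
have del2 : 0 < del / 2 by rewrite divr_gt0.
have [[e y] /= [Ee Dy e_del y_del pmin]] := penalty_minimum kap del2.
have [d dE] : exists d, d = e - y by exists (e - y).
have e_lt : `|e - yb| < del by rewrite (le_lt_trans e_del) //; lra.
have y_lt : `|y - yb| < del by rewrite (le_lt_trans y_del) //; lra.
have dot_le : kap * edot d d + edot (y - yb) (y - yb) <= C * enorm d.
  have /= := pmin (yb, yb) Eyb Dyb.
  rewrite /penalty /= subrr normr0 edot0l mulr0 !addr0 => /(_ _ _)/=.
  move=> /(_ (ltW del2) (ltW del2)); have := yb_min Ee Dy e_lt y_lt.
  rewrite -dE; lra.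
have Cd_le : C * enorm d <= C * c1 * `|d| by rewrite -mulrA ler_wpM2l.
have d_sqr : kap * `|d| ^+ 2 <= B * `|d|.
  have h : kap * edot d d <= C * c1 * `|d|.
    by have := edotxx_ge0 (y - yb); move: dot_le Cd_le; lra.
  have := ler_pM2l c2_gt0 (kap * edot d d) (C * c1 * `|d|); rewrite h.
  have := ler_pM2l kap_gt0 (`|d| ^+ 2) (c2 * edot d d); rewrite norm_le /B.
  by move=> h1 h2; lra.
have kd_le : kap * `|d| <= B.
  have [->|dN0] := eqVneq d 0; first by rewrite normr0 mulr0.
  have d_gt0 : 0 < `|d| by rewrite normr_gt0.
  by rewrite -(ler_pM2r d_gt0) -mulrA -expr2.
have ky_le : kap * `|y - yb| ^+ 2 <= B ^+ 2.
  have : `|y - yb| ^+ 2 <= B * `|d|.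
    have h : edot (y - yb) (y - yb) <= C * c1 * `|d|.
      have := mulr_ge0 (ltW kap_gt0) (edotxx_ge0 d).
      by move: dot_le Cd_le; lra.
    rewrite (le_trans (norm_le _)) // /B -mulrA ler_pM2l //.
  move=> h; apply: (@le_trans _ _ (kap * (B * `|d|)));
    first by rewrite ler_pM2l.
  by rewrite mulrCA expr2 ler_wpM2l.
have y_r : `|y - yb| < r.
  rewrite -(ltr_pXn2r (n := 2)) ?nnegrE ?(ltW r_gt0) // -(ltr_pM2l kap_gt0).
  apply: (le_lt_trans ky_le).
  rewrite /kap !mulrDl divfK ?expf_neq0 ?gt_eqF // -addrA ltrDl mul1r.
  by rewrite ltr_wpDl ?exprn_gt0 // mulr_ge0 // sqr_ge0.
have d_r : `|d| < r.
  rewrite -(ltr_pM2l kap_gt0); apply: (le_lt_trans kd_le).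
  rewrite /kap !mulrDl divfK ?gt_eqF // mul1r -addrA ltr_wpDl //.
    exact: mulr_ge0 Br2_ge0 (ltW r_gt0).
  by rewrite ltrDl.
have e_r : `|e - yb| < del / 2.
  have -> : e - yb = d + (y - yb) by rewrite dE addrA subrK.
  rewrite (le_lt_trans (ler_normD _ _)) //.
  by move: d_r y_r r_del; lra.
have y_r' : `|y - yb| < del / 2.
  by move: y_r r_del; lra.
(* Optimality in [e] over the subspace: the gradient is a multiple of [d], and both [u] and [- u]
   are tangent directions. *)
have d_orth u : E u -> edot d u = 0.
  move=> Eu.
  have nE : regular_normal_cone E e (- (kap *: d)).
    apply: (@regular_normal_quadratic _ _ _ _ _ (kap / 2) (del / 2 - `|e - yb|)).
      by rewrite subr_gt0.
    move=> e' Ee' e'_lt.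
    have e'_del : `|e' - yb| <= del / 2.
      have -> : e' - yb = (e' - e) + (e - yb) by rewrite addrA subrK.
      by rewrite (le_trans (ler_normD _ _)) //; move: e'_lt; lra.
    have := pmin (e', y) Ee' Dy e'_del y_del; rewrite /penalty /=.
    have -> : e' - y = (e' - e) + d by rewrite dE addrA subrK.
    move: (e' - e) => v; rewrite -dE !(edotDl, edotDr, edotZl) (edotC d v).
    lra.
  have Eu' : E (- u).
    have E0 : E 0 by rewrite -(subrr u) addrC -scaleN1r; exact: E_lin.
    by rewrite -scaleN1r -(addr0 (-1 *: u)); exact: E_lin.
  have := nE _ (tangent_cone_subspace E_lin Ee Eu).
  have := nE _ (tangent_cone_subspace E_lin Ee Eu').
  rewrite edotNr !edotNl !edotZl => h1 h2.
  have : kap * edot d u = 0 by lra.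
  by move/eqP; rewrite mulf_eq0 gt_eqF //= => /eqP.
(* This is minus the gradient of the penalty function in its second variable. Against [E] the
   summand with [d] vanishes, which leaves only [- 2 (y - yb)]. *)
exists y, (- (l - (2 * kap) *: d + 2 *: (y - yb))); split => //.
- exact: lt_le_trans y_r r_eps.
- rewrite normrN (le_trans (ler_normD _ _)) //.
  rewrite (le_trans (lerD (ler_normB _ _) (lexx _))) //.
  rewrite !normrZ !ger0_norm ?mulr_ge0 ?ltW //.
  move: kd_le y_lt; lra.
(* The penalty function is quadratic in [y] with second-order term [(kap + 1) edot v v], so the
   expansion is exact. *)
- apply: (@regular_normal_quadratic _ _ _ _ _ (kap + 1) (del / 2 - `|y - yb|)).
    by rewrite subr_gt0.
  move=> y' Dy' y'_lt.
  have y'_del : `|y' - yb| <= del / 2.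
    have -> : y' - yb = (y' - y) + (y - yb) by rewrite addrA subrK.
    by rewrite (le_trans (ler_normD _ _)) //; move: y'_lt; lra.
  have := pmin (e, y') Ee Dy' e_del y'_del; rewrite /penalty /=.
  have [v vE] : exists v, v = y' - y by exists (y' - y).
  have -> : e - y' = d - v by rewrite dE vE opprB addrA subrK.
  have -> : y' - yb = v + (y - yb) by rewrite vE addrA subrK.
  have -> : y' = v + y by rewrite vE subrK.
  rewrite -dE !(edotBl, edotBr, edotDl, edotDr, edotZl).
  rewrite !(edotC v) !(edotC y yb) !(edotC y v); nra.
- move=> u Eu.
  have -> : - (l - (2 * kap) *: d + 2 *: (y - yb)) + l =
      (2 * kap) *: d - 2 *: (y - yb) by rewrite opprD opprB addrAC subrK.
  by rewrite (edotBl (_ *: d)) !edotZl d_orth // mulr0 sub0r mulNr.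
Qed.

(** The approximate multipliers stay in a fixed compact ball, so they have a cluster point; their
    defect on [E] is a multiple of [y - yb] and tends to zero. *)
Lemma exists_multiplier : exists2 eta,
  limiting_normal_cone D yb eta & forall e, E e -> edot (eta + l) e = 0.
Proof.
have [B hB] := approximate_multiplier.
have /choice[p hp] (k : nat) : exists p : Y * Y, [/\ D p.1,
    `|p.1 - yb| < harmonic k, `|p.2| <= B, regular_normal_cone D p.1 p.2 &
    forall e, E e -> edot (p.2 + l) e = - 2 * edot (p.1 - yb) e].
  by have [y [eta h]] := hB _ (harmonic_gt0 k); exists (y, eta).
have FB : fmap (fun k => (p k).2) \oo [set y : Y | `|y| <= B].
  by exists 0%N => // k _ /=; case: (hp k).
have [eta [_ eta_cl]] := @compact_norm_le R Y B _ _ FB.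
(* The cluster point meets the image of the tail where [harmonic k < eps], so one index serves both
   estimates and no subsequence has to be extracted. *)
have close (eps : R) : 0 < eps ->
    exists k, `|(p k).2 - eta| < eps /\ harmonic k < eps.
  move=> eps_gt0.
  have [||z [/= [k kz k_lt] z_lt]] := eta_cl
    ((fun k => (p k).2) @` [set k | harmonic k < eps])
    [set z | `|z - eta| < eps].
  - have /cvgrPdist_lt/(_ _ eps_gt0) := @cvg_harmonic R.
    apply: filterS => k; rewrite sub0r normrN gtr0_norm ?harmonic_gt0 // => kl.
    by exists k.
  - apply/nbhs_normP; exists eps => // z /=; by rewrite distrC.
  by exists k; rewrite k_lt.
exists eta.
- apply: limiting_normal_approx => eps /close[k [k1 k2]].
  case: (hp k) => Dk yk _ nk _; exists (p k).1, (p k).2; split => //.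
  exact: lt_trans k2.
- move=> u Eu; have [c c_gt0 hc] := @edot_bound R Y.
  have lim (eps : R) : 0 < eps -> `|edot (eta + l) u| <= eps.
    (* One share of the error comes from [eta] and two from the defect [2 (y - yb)]; adding 1 keeps
       [M] positive when [u] is zero. *)
    move=> eps_gt0; pose M := 3 * c * (`|u| + 1).
    have M_gt0 : 0 < M by rewrite !mulr_gt0 // ltr_wpDl.
    have [k [k1 k2]] := close _ (divr_gt0 eps_gt0 M_gt0).
    case: (hp k) => _ yk _ _ /(_ u Eu) hk.
    have -> : edot (eta + l) u =
        - edot ((p k).2 - eta) u - 2 * edot ((p k).1 - yb) u.
      by move: hk; rewrite !edotBl !edotDl; lra.
    rewrite (le_trans (ler_normB _ _)) // normrN normrM ger0_norm //.
    have e1 := hc ((p k).2 - eta) u; have e2 := hc ((p k).1 - yb) u.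
    set t := eps / M in k1 k2.
    have u1 : c * (`|(p k).2 - eta| * `|u|) <= c * (t * (`|u| + 1)).
      by rewrite ler_pM2l // ler_pM // ?ltW // ltrDl.
    have u2 : c * (`|(p k).1 - yb| * `|u|) <= c * (t * (`|u| + 1)).
      by rewrite ler_pM2l // ler_pM // ?ltW ?ltrDl //; exact: lt_trans k2.
    have <- : M * t = eps by rewrite mulrC divfK // gt_eqF.
    rewrite /M; move: e1 e2 u1 u2; lra.
  apply/eqP; rewrite -normr_eq0 eq_le normr_ge0 andbT.
  by apply/ler_addgt0Pr => eps /lim; rewrite add0r.
Qed.

End multiplier.

(** * Normals to products, Lipschitz functions, and error bounds from subregularity *)

Section error_bound_multipliers.
Set Implicit Arguments.
Unset Strict Implicit.
Context {R : realType}.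

(** Testing a normal only against tangents of the form [(d, 0)] and [(0, d)] suffices; these are
    tangent to the product because the other coordinate can stay fixed. *)
Lemma regular_normal_cone_setX (V W : euclideanType R) (A : set V) (B : set W)
    (a : V) (b : W) (p : V * W) : A a -> B b ->
  regular_normal_cone (A `*` B) (a, b) p ->
  regular_normal_cone A a p.1 /\ regular_normal_cone B b p.2.
Proof.
move=> Aa Bb np; split=> d [t [dk [t_gt0 t0 dkd dkA]]].
- have := np (d, 0); rewrite {1}/edot /= /proddot /= edot0r addr0; apply.
  exists t, (fun k => (dk k, 0)); split=> //.
    by apply: cvg_pair => //; exact: cvg_cst.
  by move=> k; split; [exact: dkA|rewrite /= scaler0 addr0].
- have := np (0, d); rewrite {1}/edot /= /proddot /= edot0r add0r; apply.
  exists t, (fun k => (0, dk k)); split=> //.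
    by apply: cvg_pair => //; exact: cvg_cst.
  by move=> k; split; [rewrite /= scaler0 addr0|exact: dkA].
Qed.

Lemma limiting_normal_cone_setX (V W : euclideanType R) (A : set V) (B : set W)
    (a : V) (b : W) (p : V * W) :
  limiting_normal_cone (A `*` B) (a, b) p ->
  limiting_normal_cone A a p.1 /\ limiting_normal_cone B b p.2.
Proof.
move=> [z [xi [zAB zab xip nz]]].
have nz' k := regular_normal_cone_setX (zAB k).1 (zAB k).2
  (eq_ind _ (fun q => regular_normal_cone _ q _) (nz k) _
    (surjective_pairing _)).
split; [exists (fst \o z), (fst \o xi)|exists (snd \o z), (snd \o xi)]; split.
- by move=> k; case: (zAB k).
- by apply: cvg_comp zab _; exact: cvg_fst.
- by apply: cvg_comp xip _; exact: cvg_fst.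
- by move=> k; case: (nz' k).
- by move=> k; case: (zAB k).
- by apply: cvg_comp zab _; exact: cvg_snd.
- by apply: cvg_comp xip _; exact: cvg_snd.
- by move=> k; case: (nz' k).
Qed.

Lemma closed_setX (T U : topologicalType) (A : set T) (B : set U) :
  closed A -> closed B -> closed (A `*` B).
Proof.
move=> cA cB; have -> : A `*` B = fst @^-1` A `&` snd @^-1` B by [].
by apply: closedI; apply: preimage_closed => // p _;
  [exact: cvg_fst|exact: cvg_snd].
Qed.

Lemma locally_lipschitz_ball (V : euclideanType R) (f : V -> R) (z : V) :
  locally_lipschitz f -> exists L del : R, [/\ 0 <= L, 0 < del &
    forall x y, `|x - z| < del -> `|y - z| < del ->
      `|f x - f y| <= L * enorm (x - y)].
Proof.
move=> /(_ z)[L [[A B] /= [/nbhs_normP[a a_gt0 aA]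
  /nbhs_normP[b b_gt0 bB]] AB]].
exists `|L|, (Num.min a b); split=> //; first by rewrite lt_min a_gt0.
move=> x y; rewrite !lt_min => /andP[xa _] /andP[_ yb].
have Ax : A x by apply: aA; rewrite /= distrC.
have By : B y by apply: bB; rewrite /= distrC.
have := AB (x, y) (conj Ax By) => /= /le_trans; apply.
by rewrite ler_wpM2r ?enorm_ge0 // ler_norm.
Qed.

Lemma locally_lipschitz_continuous (V : euclideanType R) (f : V -> R) :
  locally_lipschitz f -> continuous f.
Proof.
move=> f_lip z.
have [L [del [L_ge0 del_gt0 hL]]] := locally_lipschitz_ball z f_lip.
have [c c_gt0 hc] := @enorm_bound R V.
apply/cvgrPdist_lt => eps eps_gt0.
pose e := Num.min del (eps / (L * c + 1)).
have Lc_gt0 : 0 < L * c + 1 by rewrite ltr_wpDl // mulr_ge0 // ltW.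
have e_gt0 : 0 < e by rewrite lt_min del_gt0 divr_gt0.
apply/nbhs_normP; exists e => // x /=; rewrite /e lt_min distrC => /andP[x1 x2].
rewrite distrC (le_lt_trans (hL _ _ x1 _)) ?subrr ?normr0 //.
rewrite (le_lt_trans (ler_wpM2l L_ge0 (hc _))) //.
move: x2; rewrite ltr_pdivlMr //; have := normr_ge0 (x - z); lra.
Qed.

Lemma epi_closed (V : euclideanType R) (f : V -> R) :
  continuous f -> closed (epi f).
Proof.
move=> fc; have -> : epi f =
    (fun p : V * R^o => p.2 - f p.1) @^-1` [set r | 0 <= r].
  by apply/seteqP; split=> p; rewrite /epi /= subr_ge0.
apply: preimage_closed; last exact: closed_ge.
move=> p _; apply: cvgB; first exact: cvg_snd.
by apply: continuous_comp; [exact: cvg_fst|exact: fc].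
Qed.

(** The subspace in the penalization below is given as a fixed-point set, so its closedness reduces
    to continuity of one map. *)
Lemma fixed_closed (V : normedModType R) (P : V -> V) :
  continuous P -> closed [set y | P y = y].
Proof.
move=> Pc; have -> : [set y | P y = y] =
    (fun y => `|P y - y|) @^-1` [set r | r = 0].
  apply/seteqP; split=> y /=; first by move=> ->; rewrite subrr normr0.
  by move/normr0_eq0/subr0_eq.
apply: preimage_closed; last exact: closed_eq.
move=> y _; apply: cvg_norm; apply: cvgB; [exact: Pc|exact: cvg_id].
Qed.

(** Any [w] in [Y z] bounds the distance on the right from above; the slack [eps] pays for picking
    an actual point that nearly realizes the infimum on the left. *)
Lemma metrically_subregular_error_bound (V W : euclideanType R)
    (Y : V -> set W) (zb : V) (wb : W) : metrically_subregular Y zb wb ->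
  exists kappa del : R, [/\ 0 < kappa, 0 < del & forall z w eps,
    `|z - zb| < del -> Y z w -> 0 < eps ->
    exists2 z', Y z' wb & enorm (z' - z) <= kappa * enorm (w - wb) + eps].
Proof.
move=> [_ [kappa kappa_gt0 /nbhs_normP[del del_gt0 h]]].
exists kappa, del; split=> // z w eps z_del Yw eps_gt0.
have z_in : ball_ Num.norm zb del z by rewrite /= distrC.
have dist_le : (eucl_dist wb (Y z) <= (enorm (w - wb))%:E)%E.
  by apply: ereal_inf_lbound; exists w.
have : (eucl_dist z (svinv Y wb) < (kappa * enorm (w - wb) + eps)%:E)%E.
  apply: le_lt_trans (h _ z_in) _.
  apply: (@le_lt_trans _ _ (kappa%:E * (enorm (w - wb))%:E)%E).
    by rewrite lee_wpmul2l // lee_fin ltW.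
  by rewrite -EFinM lte_fin ltrDl.
move=> /ereal_inf_lt[_ [z' Yz' <-]]; rewrite lte_fin => /ltW z'_le.
by exists z'.
Qed.

End error_bound_multipliers.

(** * Exact penalization under an error bound *)

Section penalization.
Set Implicit Arguments.
Unset Strict Implicit.
Context {R : realType} {Z U W : euclideanType R}.
(** One framework for two decouplings. [D] is [gph calH_map] with [B] zero, or [gph F] times [gph G]
    with [B p = (p, 0)]; the residuals [y.2 - B y.1] and [y.1.1 - x] measure how far a point of [D]
    and a point of [M] are from fitting together. *)
Variables (f : Z -> R) (Feas M : set Z) (D : set (Z * U * W)).
Variables (B : Z * U -> W) (pb : Z * U) (C del : R).
Hypotheses (f_lip : locally_lipschitz f) (M_closed : closed M).
Hypotheses (D_closed : closed D) (B_cont : continuous B).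
Hypothesis B_lin : forall a u v, B (a *: u + v) = a *: B u + B v.
Hypotheses (Mpb : M pb.1) (Dpb : D (pb, B pb)).
Hypothesis f_min : \forall z \near pb.1, Feas z -> f pb.1 <= f z.
Hypotheses (C_ge0 : 0 <= C) (del_gt0 : 0 < del).
Hypothesis B_le : forall p, enorm (B p) <= enorm p.
Hypothesis error_bound : forall y x eps, D y -> M x ->
  `|y - (pb, B pb)| < del -> `|x - pb.1| < del -> 0 < eps ->
  exists2 z, Feas z &
    enorm (z - y.1.1) <= C * (enorm (y.2 - B y.1) + enorm (y.1.1 - x)) + eps.

Let B_sub u v : B (u - v) = B u - B v.
Proof.
by rewrite addrC -scaleN1r B_lin scaleN1r addrC.
Qed.

Let C1 : R := 2 * C + 1.

(** Moves the error bound from [y] to a free point [p]. Passing from [y] to [(p, B p)] costs the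
    distance N between them once in each of the two residuals and once in the base point, whence
    [2 * C + 1]. *)
Let error_bound_graph p y x eps : D y -> M x ->
  `|y - (pb, B pb)| < del -> `|x - pb.1| < del -> 0 < eps ->
  exists2 z, Feas z &
    enorm (z - p.1) <= C1 * (enorm ((p, B p) - y) + enorm (p.1 - x)) + eps.
Proof.
move=> Dy Mx y_d x_d eps_gt0.
have [z Fz z_le] := error_bound Dy Mx y_d x_d eps_gt0; exists z => //.
have yE : enorm ((p, B p) - y) =
    enorm (p.1 - y.1.1) + enorm (p.2 - y.1.2) + enorm (B p - y.2) by [].
have res_le : enorm (y.2 - B y.1) <= enorm ((p, B p) - y).
  rewrite (le_trans (enorm_triangle (B p) _ _)) // -B_sub addrC.
  by rewrite (enormB y.2) lerD // B_le.
have yp_le : enorm (y.1.1 - p.1) <= enorm ((p, B p) - y).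
  by rewrite yE enormB -addrA lerDl addr_ge0 ?enorm_ge0.
have yx_le := enorm_triangle p.1 y.1.1 x.
have zp_le := enorm_triangle y.1.1 z p.1.
have N_ge0 := enorm_ge0 ((p, B p) - y); have px_ge0 := enorm_ge0 (p.1 - x).
have : C * (enorm (y.2 - B y.1) + enorm (y.1.1 - x)) <=
    C * (2 * enorm ((p, B p) - y) + enorm (p.1 - x)).
  by rewrite ler_wpM2l //; lra.
have := mulr_ge0 C_ge0 px_ge0; rewrite /C1; lra.
Qed.

(** The three factors carry independent copies of the variable, for [epi f], [D] and [M]. *)
Local Notation Y := (Z * R^o * (Z * U * W) * Z)%type.

Let base : Y := ((pb.1, f pb.1), (pb, B pb), pb.1).

(* The fixed points of [lift] are the points [((p.1, r), (p, B p), p.1)]. *)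
Let lift (y : Y) : Y := ((y.1.2.1.1, y.1.1.2), (y.1.2.1, B y.1.2.1), y.1.2.1.1).

Let lift_cont : continuous lift.
Proof.
move=> y.
have c1 : (fun q : Y => q.1) @ y --> y.1 by exact: cvg_fst.
have c12 : (fun q : Y => q.1.2) @ y --> y.1.2.
  by apply: cvg_comp c1 _; exact: cvg_snd.
have c121 : (fun q : Y => q.1.2.1) @ y --> y.1.2.1.
  by apply: cvg_comp c12 _; exact: cvg_fst.
have c1211 : (fun q : Y => q.1.2.1.1) @ y --> y.1.2.1.1.
  by apply: cvg_comp c121 _; exact: cvg_fst.
have c112 : (fun q : Y => q.1.1.2) @ y --> y.1.1.2.
  apply: (@cvg_comp _ _ _ (fun q : Y => q.1.1) snd _ (nbhs y.1.1)).
    by apply: cvg_comp c1 _; exact: cvg_fst.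
  exact: cvg_snd.
have cB : (fun q : Y => B q.1.2.1) @ y --> B y.1.2.1.
  by apply: cvg_comp c121 _; exact: B_cont.
exact: (cvg_pair (cvg_pair (cvg_pair c1211 c112) (cvg_pair c121 cB)) c1211).
Qed.

Let lift_lin a u v : lift u = u -> lift v = v -> lift (a *: u + v) = a *: u + v.
Proof. by move=> {2}<- {2}<-; rewrite /lift /= B_lin. Qed.

(** Near any pair [e], [y] lies a feasible [z] at distance of order [enorm (e - y)]; by the
    Lipschitz property [f z] exceeds the height [y.1.1.2] by at most that order, while
    [f pb.1 <= f z]. *)
Let penalized_min :
  exists C' del' : R, [/\ 0 <= C', 0 < del' &
    forall e y : Y, lift e = e -> (epi f `*` D `*` M) y ->
      `|e - base| < del' -> `|y - base| < del' ->
      f pb.1 <= y.1.1.2 + C' * enorm (e - y)].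
Proof.
have C1_ge0 : 0 <= C1 by rewrite addr_ge0 // mulr_ge0.
have [L [dL [L_ge0 dL_gt0 hL]]] := locally_lipschitz_ball pb.1 f_lip.
have [r r_gt0 hr] := (nbhs_normP _ _).1 f_min.
have [c c_gt0 hc] := @enorm_bound R Y.
pose d0 := Num.min r dL.
have d0_gt0 : 0 < d0 by rewrite lt_min r_gt0.
(* Keeps the feasible point in the region where [pb.1] is minimal and [f] Lipschitz: it is within
   [C1 * c * 2 * d + d] of [p.1], which is within [d] of [pb.1]. *)
pose K := C1 * c * 2 + 3.
have K_gt0 : 0 < K by rewrite ltr_wpDl // !mulr_ge0 // ltW.
pose d := Num.min del (Num.min dL (d0 / K)).
have d_gt0 : 0 < d by rewrite !lt_min del_gt0 dL_gt0 divr_gt0.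
have d_del : d <= del by rewrite ge_min lexx.
have d_dL : d <= dL by rewrite !ge_min lexx !orbT.
have d_d0 : K * d <= d0.
  by rewrite mulrC -ler_pdivlMr // !ge_min lexx !orbT.
(* [C1] accounts for the step from [z] to [p.1], and 1 for the step from [p.1] to the point at which
   the epigraph copy evaluates [f]. *)
exists (L * (C1 + 1)), d; split => //; first by rewrite mulr_ge0 // addr_ge0.
move=> e y eE [[ey Dy] My] e_d y_d.
have N_le : enorm (e - y) <= c * (2 * d).
  rewrite (le_trans (hc _)) // ler_pM2l // -(subrKA base e (- y)).
  rewrite (le_trans (ler_normD _ _)) // (distrC base); lra.
move: eE ey Dy My e_d y_d N_le; case: e => [[[z0 r0] [p w0]] x0].
case: y => [[[z1 r1] w1] x1]; rewrite /lift /= => -[<- <- <-].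
rewrite /epi /= => f_le Dw1 Mx1.
rewrite !prod_normE /= !gt_max => /andP[/andP[/andP[_ _] /andP[/andP[p1_d _] _]] _].
move=> /andP[/andP[/andP[z1_d _] w1_d] x1_d].
have {}w1_d : `|w1 - (pb, B pb)| < d by rewrite !prod_normE /= !gt_max.
set N := enorm _ => N_le.
have NE : N = enorm (p.1 - z1) + `|r0 - r1| + enorm ((p, B p) - w1)
    + enorm (p.1 - x1) by [].
have := enorm_ge0 (p.1 - z1); have := normr_ge0 (r0 - r1) => r_ge0 pz_ge0.
have := enorm_ge0 (p.1 - x1); have := enorm_ge0 ((p, B p) - w1) => w_ge0 px_ge0.
apply/ler_addgt0Pr => eps eps_gt0.
pose eps' := Num.min d (eps / (L + 1)).
have L1_gt0 : 0 < L + 1 by rewrite ltr_wpDl.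
have eps'_gt0 : 0 < eps' by rewrite lt_min d_gt0 divr_gt0.
have eps'_d : eps' <= d by rewrite ge_min lexx.
have eps'_eps : eps' * (L + 1) <= eps.
  by rewrite -ler_pdivlMr // ge_min lexx orbT.
have [z Fz z_le] := error_bound_graph p Dw1 Mx1
  (lt_le_trans w1_d d_del) (lt_le_trans x1_d d_del) eps'_gt0.
have z_N : enorm (z - p.1) <= C1 * N + eps'.
  rewrite (le_trans z_le) // lerD2r ler_wpM2l // NE; lra.
have z_d : `|z - pb.1| < d0.
  rewrite -(subrKA p.1 z (- pb.1)) (le_lt_trans (ler_normD _ _)) //.
  have := ler_norm_enorm (z - p.1).
  have : C1 * N <= C1 * (c * (2 * d)) by rewrite ler_wpM2l.
  move: d_d0; rewrite /K; lra.
have [z_r z_dL] : `|z - pb.1| < r /\ `|z - pb.1| < dL.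
  by apply/andP; rewrite -lt_min.
have z1_dL : `|z1 - pb.1| < dL by exact: lt_le_trans z1_d d_dL.
have fz : f pb.1 <= f z by apply: hr Fz; rewrite /= distrC.
have zz1 : f z <= f z1 + L * enorm (z - z1).
  by have := hL _ _ z_dL z1_dL; rewrite ler_norml; lra.
have tri := enorm_triangle p.1 z z1.
have : L * enorm (z - z1) <= L * ((C1 * N + eps') + N).
  rewrite ler_wpM2l // (le_trans tri) // lerD // NE; lra.
lra.
Qed.

Lemma penalty_multipliers : exists xi eta zeta,
  [/\ limiting_subdifferential f pb.1 xi,
      limiting_normal_cone D (pb, B pb) eta,
      limiting_normal_cone M pb.1 zeta &
      forall p, edot xi p.1 + edot eta (p, B p) + edot zeta p.1 = 0].
Proof.
have [C' [del' [C'_ge0 del'_gt0 hmin]]] := penalized_min.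
(* The objective is the height coordinate of the epigraph copy. *)
pose l : Y := ((0, 1 : R^o), 0, 0).
have edotE (u y : Y) : edot u y =
    edot u.1.1.1 y.1.1.1 + u.1.1.2 * y.1.1.2 + edot u.1.2 y.1.2 + edot u.2 y.2.
  by [].
have lE (y : Y) : edot l y = y.1.1.2.
  by rewrite edotE /= !edot0l mul1r add0r !addr0.
have Dt_closed : closed (epi f `*` D `*` M).
  do 2!apply: closed_setX => //.
  exact: epi_closed (locally_lipschitz_continuous f_lip).
have Dt_base : (epi f `*` D `*` M) base by do !split => //=; rewrite /epi /=.
have lift_base : [set y | lift y = y] base by [].
have base_min (e y : Y) : [set y | lift y = y] e -> (epi f `*` D `*` M) y ->
    `|e - base| < del' -> `|y - base| < del' ->
    edot l base <= edot l y + C' * enorm (e - y).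
  by rewrite !lE; exact: hmin.
have [[[[xi rho] eta] zeta]] := exists_multiplier (fixed_closed lift_cont)
  Dt_closed lift_lin lift_base Dt_base C'_ge0 del'_gt0 base_min.
move=> /limiting_normal_cone_setX[/limiting_normal_cone_setX[/= n1 n2] n3] orth.
have B0 : B 0 = 0.
  by apply: (addrI (B 0)); rewrite -{1}[B 0]scale1r -B_lin scaler0 !addr0.
have {}orth e : lift e = e -> edot ((xi, rho, eta, zeta) : Y) e + e.1.1.2 = 0.
  by move=> /orth; rewrite edotDl lE.
(* Only the height coordinate is moved in this test; it normalizes the epigraph normal to
   [(xi, -1)], that is, to a subgradient. *)
have rho1 : rho = -1.
  have := orth ((0, 1), (0, B 0), 0) erefl.
  rewrite edotE /= B0 !edot0r mulr1 add0r !addr0 => /eqP.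
  by rewrite addr_eq0 => /eqP.
exists xi, eta, zeta; split => //.
  by rewrite /limiting_subdifferential /= -rho1.
move=> p; have := orth ((p.1, 0), (p, B p), p.1) erefl.
by rewrite edotE /= mulr0 !addr0.
Qed.

End penalization.

(** * Explicit M-stationarity under the four assumptions *)

Section stationarity.
Set Implicit Arguments.
Unset Strict Implicit.
Context {R : realType} {n m s : nat}.
Local Notation Z := ('rV[R]_n).
Local Notation L := ('rV[R]_m).
Local Notation S := ('rV[R]_s).
Variables (f : Z -> R) (F : Z -> set L) (G : Z * L -> set S) (M : set Z).
Hypotheses (f_lip : locally_lipschitz f) (F_closed : closed (gph F)).
Hypotheses (G_closed : closed (gph G)) (M_closed : closed M).
Variable zb : Z.
Hypothesis zb_min : local_minimizer f F G M zb.

Let zb_feasible : feasible F G M zb := zb_min.1.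

Lemma calH_mapP z (l : L) a w :
  calH_map F G (z, l) (a, w) <-> F z (l + a) /\ G (z, l) w.
Proof.
split=> -[/= Fa Gw]; split=> //=; last by exists (l + a); rewrite // addrC addKr.
by case: Fa => y Fy <-; rewrite addrC subrK.
Qed.

Lemma calH_closed : closed (gph (calH_map F G)).
Proof.
have -> : gph (calH_map F G) =
    (fun p : Z * L * (L * S) => (p.1.1, p.1.2 + p.2.1)) @^-1` gph F `&`
    (fun p : Z * L * (L * S) => (p.1, p.2.2)) @^-1` gph G.
  by apply/seteqP; split=> -[[z l] [a w]] /calH_mapP.
have proj (p : Z * L * (L * S)) :
    [/\ q.1 @[q --> p] --> p.1, q.1.1 @[q --> p] --> p.1.1,
        q.1.2 @[q --> p] --> p.1.2, q.2.1 @[q --> p] --> p.2.1 &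
        q.2.2 @[q --> p] --> p.2.2].
  have c1 : (fun q : Z * L * (L * S) => q.1) @ p --> p.1 by exact: cvg_fst.
  have c2 : (fun q : Z * L * (L * S) => q.2) @ p --> p.2 by exact: cvg_snd.
  split=> //.
  - by apply: cvg_comp c1 _; exact: cvg_fst.
  - by apply: cvg_comp c1 _; exact: cvg_snd.
  - by apply: cvg_comp c2 _; exact: cvg_fst.
  - by apply: cvg_comp c2 _; exact: cvg_snd.
apply: closedI; apply: preimage_closed => // p _;
  have [c1 c11 c12 c21 c22] := proj p.
- exact: (cvg_pair c11 (cvgD c12 c21)).
- exact: (cvg_pair c1 c22).
Qed.

(** Penalization with [D] the graph of [calH_map] and [B] zero. Orthogonality kills the component of
    the normal along lambda and balances the one along z; the inclusion then splits this normal into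
    coderivatives of [F] and [G]. *)
Lemma calH_stationary (l : L) (C del : R) : K_map F G zb l ->
  coderivative_inclusion F G zb l -> 0 <= C -> 0 < del ->
  (forall (y : Z * L * (L * S)) (x : Z) (eps : R),
    gph (calH_map F G) y -> M x -> `|y - ((zb, l), 0)| < del ->
    `|x - zb| < del -> 0 < eps ->
    exists2 z, feasible F G M z &
      enorm (z - y.1.1) <= C * (enorm y.2 + enorm (y.1.1 - x)) + eps) ->
  explicitly_M_stationary f F G M zb.
Proof.
move=> Kl inc C_ge0 del_gt0 h.
have B_lin (a : R) (u v : Z * L) : (0 : L * S) = a *: 0 + 0.
  by rewrite scaler0 addr0.
have B_cont : continuous (fun _ : Z * L => 0 : L * S).
  by move=> p; exact: cvg_cst.
have B_le (p : Z * L) : enorm (0 : L * S) <= enorm p.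
  by rewrite enorm0 enorm_ge0.
have Dpb : gph (calH_map F G) ((zb, l), 0).
  by apply/calH_mapP; rewrite addr0.
have h' (y : Z * L * (L * S)) (x : Z) (eps : R) :
    gph (calH_map F G) y -> M x -> `|y - ((zb, l), 0)| < del ->
    `|x - zb| < del -> 0 < eps ->
    exists2 z, feasible F G M z &
      enorm (z - y.1.1) <= C * (enorm (y.2 - 0) + enorm (y.1.1 - x)) + eps.
  by rewrite subr0; exact: h.
have [xi [[[eta1 eta2] [al om]] [zeta [xi_f /= eta_n zeta_n orth]]]] :=
  @penalty_multipliers R Z L (L * S)%type f (feasible F G M) M
    (gph (calH_map F G)) (fun=> 0) (zb, l) C del f_lip M_closed calH_closed
    B_cont B_lin zb_feasible.2 Dpb zb_min.2 C_ge0 del_gt0 B_le h'.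
have orthE z l' : edot xi z + (edot eta1 z + edot eta2 l') + edot zeta z = 0.
  have /= := orth (z, l'); rewrite {2}/edot /= /proddot /= edot0r addr0.
  by rewrite {2}/edot /= /proddot.
have eta2_0 : eta2 = 0.
  by apply: edot_eq0 => l'; have := orthE 0 l'; rewrite !edot0r !add0r addr0.
have sum0 : xi + eta1 + zeta = 0.
  apply: edot_eq0 => z; have := orthE z 0; rewrite edot0r addr0 => <-.
  by rewrite !edotDl.
(* The signs come from the coderivative pairing a normal with [- eta]. As [eta2] is zero, the lambda
   part of the [G] term must be the multiplier [- al] itself. *)
have [] := inc (- al) (- om) (eta1, eta2).
  by rewrite /coderivative /= (_ : - (- al, - om) = (al, om)) //;
    congr pair; rewrite opprK.
move=> [xi1 l1] /= [xi1F ->] [[xi2 l2] xi2G [e1]]; rewrite eta2_0 opprK => e2.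
split=> //; exists l, (- al), (- om); split=> //.
exists (xi + xi1 + xi2); last by exists zeta; rewrite // -(addrA xi) e1.
exists (xi + xi1); first by exists xi => //; exists xi1.
have l2E : l2 = - al by apply/eqP; rewrite -addr_eq0 addrC e2.
by rewrite l2E in xi2G; exists xi2; [exact: xi2G|].
Qed.

(** Penalization with [D] the product of the two graphs and [B p = (p, 0)]: a normal to the product
    splits into a normal to each graph. *)
Lemma gph_stationary (l : L) (C del : R) : K_map F G zb l ->
  0 <= C -> 0 < del ->
  (forall (p : Z * L) (q : Z * L * S) (x : Z) (eps : R),
    gph F p -> gph G q -> M x -> `|p - (zb, l)| < del ->
    `|q - ((zb, l), 0)| < del -> `|x - zb| < del -> 0 < eps ->
    exists2 z, feasible F G M z &
      enorm (z - p.1) <= C * (enorm (q - (p, 0)) + enorm (p.1 - x)) + eps) ->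
  explicitly_M_stationary f F G M zb.
Proof.
move=> Kl C_ge0 del_gt0 h.
pose B (p : Z * L) : Z * L * S := (p, 0).
have B_lin (a : R) (u v : Z * L) : B (a *: u + v) = a *: B u + B v.
  by congr pair; rewrite /= scaler0 addr0.
have B_cont : continuous B.
  by move=> p; exact: (cvg_pair cvg_id (cvg_cst _)).
have B_le (p : Z * L) : enorm (B p) <= enorm p.
  by rewrite {1}/enorm /= /prodnorm /= enorm0 addr0.
have Dpb : (gph F `*` gph G) ((zb, l), B (zb, l)) by case: Kl.
have h' (y : Z * L * (Z * L * S)) (x : Z) (eps : R) :
    (gph F `*` gph G) y -> M x -> `|y - ((zb, l), B (zb, l))| < del ->
    `|x - zb| < del -> 0 < eps ->
    exists2 z, feasible F G M z &
      enorm (z - y.1.1) <= C * (enorm (y.2 - B y.1) + enorm (y.1.1 - x)) + eps.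
  move=> [Fy Gy] Mx; rewrite prod_normE gt_max => /andP[y1_d y2_d].
  exact: h.
have [xi [[eta theta] [zeta [xi_f /= n12 zeta_n orth]]]] :=
  @penalty_multipliers R Z L (Z * L * S)%type f (feasible F G M) M
    (gph F `*` gph G) B (zb, l) C del f_lip M_closed
    (closed_setX F_closed G_closed) B_cont B_lin zb_feasible.2 Dpb zb_min.2
    C_ge0 del_gt0 B_le h'.
have [/= nF nG] := limiting_normal_cone_setX n12.
case: eta theta nF nG {n12} orth => [xi1 al] [[xi2 l2] om] nF nG orth.
have orthE z l' : edot xi z + (edot xi1 z + edot al l' +
    (edot xi2 z + edot l2 l')) + edot zeta z = 0.
  rewrite -[RHS](orth (z, l')) /=; congr (_ + _ + _).
  have edotE (V W : euclideanType R) (u v : V * W) :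
    edot u v = edot u.1 v.1 + edot u.2 v.2 by [].
  by rewrite !edotE /= edot0r addr0.
(* The lambda components of the two graph normals cancel; this is the coupling of the coderivatives
   through one [mu]. *)
have l2E : l2 = - al.
  apply/eqP; rewrite -addr_eq0 addrC; apply/eqP/edot_eq0 => l'.
  by have := orthE 0 l'; rewrite !edot0r !add0r addr0 edotDl.
split=> //; exists l, (- al), (- om); split=> //.
exists (xi + xi1 + xi2).
  exists (xi + xi1).
    by exists xi; [exact: xi_f|exists xi1; rewrite // /coderivative /= opprK].
  exists xi2; last by [].
  by rewrite /= /coderivative /= -l2E opprK.
exists zeta; first exact: zeta_n.
apply: edot_eq0 => z; have := orthE z 0.
by rewrite !edot0r !addr0 => <-; rewrite !edotDl !addrA.
Qed.

(** Two error bounds composed: [z] is first moved to a [z'] with a small [w'] in [H_map F G z'],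
    then [z'] is moved to a feasible point with residual [(w', z' - x)]. *)
Lemma HM_error_bound (kappa : R) : 0 < kappa ->
  metrically_subregular (HM_map F G M) zb (0, 0) ->
  exists C del : R, [/\ 0 <= C, 0 < del &
    forall z x e eps, `|z - zb| < del -> 0 <= e -> e < del -> M x ->
      (forall eps', 0 < eps' -> exists z' w', H_map F G z' w' /\
        enorm (z' - z) + enorm w' <= kappa * e + eps') ->
      0 < eps ->
      exists2 z', feasible F G M z' &
        enorm (z' - z) <= C * (e + enorm (z - x)) + eps].
Proof.
move=> kappa_gt0 /metrically_subregular_error_bound[k [d [k_gt0 d_gt0 h]]].
have K_gt0 : 0 < kappa + 2 by rewrite addr_gt0.
have k1_gt0 : 0 < 2 * (k + 1) by rewrite mulr_gt0 // addr_gt0.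
(* The first move, of length [kappa * e], is paid once directly and [k] times in the second
   residual, which also contains [z - x]. The radius is split over [kappa * e], the slack and
   [z - zb]. *)
exists ((k + 1) * kappa + k), (d / (kappa + 2)); split; rewrite ?divr_gt0 //.
  by rewrite addr_ge0 ?mulr_ge0 ?addr_ge0 ?ltW.
move=> z x e eps z_d e_ge0 e_d Mx approx eps_gt0.
pose eps1 := Num.min (d / (kappa + 2)) (eps / (2 * (k + 1))).
have eps1_gt0 : 0 < eps1 by rewrite lt_min !divr_gt0.
have [z' [w' [Hw' zw_le]]] := approx _ eps1_gt0.
have eps1_d : eps1 <= d / (kappa + 2) by rewrite ge_min lexx.
have eps1_eps : eps1 * (2 * (k + 1)) <= eps.
  by rewrite -ler_pdivlMr // ge_min lexx orbT.
have w'_ge0 := enorm_ge0 w'; have z'z_ge0 := enorm_ge0 (z' - z).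
have z'_d : `|z' - zb| < d.
  rewrite -(subrKA z z' (- zb)) (le_lt_trans (ler_normD _ _)) //.
  have := ler_norm_enorm (z' - z).
  have dE : (d / (kappa + 2)) * (kappa + 2) = d by rewrite divfK // gt_eqF.
  have : kappa * e <= kappa * (d / (kappa + 2)) by rewrite ler_pM2l // ltW.
  lra.
have HM' : HM_map F G M z' (w', z' - x) by split=> //; exists x.
have eps2_gt0 : 0 < eps / 2 by rewrite divr_gt0.
have [z2 [/= Hz2 [x2 Mx2 /subr0_eq z2E]] z2_le] := h _ _ _ z'_d HM' eps2_gt0.
exists z2; first by split; [exact: Hz2|rewrite z2E].
have HE : enorm ((w', z' - x) - (0, 0)) = enorm w' + enorm (z' - x).
  exact: (congr1 enorm (subr0 ((w', z' - x) : S * Z))).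
have t1 := enorm_triangle z' z2 z; have t2 := enorm_triangle z z' x.
have : k * (enorm w' + enorm (z' - x)) <=
    k * (kappa * e + eps1 + enorm (z - x)).
  by rewrite ler_pM2l //; lra.
have zx_ge0 := enorm_ge0 (z - x).
have : 0 <= (k + 1) * kappa * enorm (z - x).
  exact: mulr_ge0 (mulr_ge0 (addr_ge0 (ltW k_gt0) ler01) (ltW kappa_gt0)) zx_ge0.
have : 0 <= k * e by rewrite mulr_ge0 // ltW.
move: z2_le; rewrite HE; lra.
Qed.


Lemma stationary_of_calHhat :
  metrically_subregular (HM_map F G M) zb (0, 0) ->
  (forall l, K_map F G zb l ->
    metrically_subregular (calHhat_map F G) (zb, 0, l) (0, 0) /\
    coderivative_inclusion F G zb l) ->
  explicitly_M_stationary f F G M zb.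
Proof.
move=> HM_sub Hhat; have [l Fl Gl] := zb_feasible.1.
have [Hhat_sub inc] := Hhat l (conj Fl Gl).
have [kappa [d1 [kappa_gt0 d1_gt0 h]]] :=
  metrically_subregular_error_bound Hhat_sub.
have [C [d2 [C_ge0 d2_gt0 hC]]] := HM_error_bound kappa_gt0 HM_sub.
have [c c_gt0 hc] := @enorm_bound R (L * S)%type.
pose del := Num.min d1 (Num.min d2 (d2 / c)).
have del_gt0 : 0 < del by rewrite !lt_min d1_gt0 d2_gt0 divr_gt0.
apply: (calH_stationary (conj Fl Gl) inc C_ge0 del_gt0).
move=> [[z l'] [a w]] x eps /calH_mapP[Fa Gw] Mx.
rewrite !prod_normE /= !subr0 !gt_max => /andP[/andP[z_d l_d] /andP[a_d w_d]].
move=> _; move: z_d l_d a_d w_d; rewrite !lt_min.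
move=> /and3P[z_d1 z_d2 _] /and3P[l_d1 _ _] /and3P[_ _ a_d] /and3P[_ _ w_d].
apply: hC => //; first exact: enorm_ge0.
  rewrite (le_lt_trans (hc _)) // mulrC -ltr_pdivlMr //.
  by rewrite prod_normE gt_max a_d w_d.
move=> eps' eps'_gt0.
(* Evaluating at parameter 0 puts the perturbation [w] into the residual; the nearby solution then
   supplies its own parameter [w'], with [w'] in [H_map F G z']. *)
have zl_d : `|(z, 0 : S, l') - (zb, 0, l)| < d1.
  by rewrite !prod_normE /= !gt_max subr0 normr0 z_d1 l_d1 d1_gt0.
have Hw : calHhat_map F G (z, 0, l') (a, w).
  split=> /=; last by exists w; rewrite ?subr0.
  by exists (l' + a); rewrite // addrC addKr.
have [[[z' w'] l2] [/= [y1 Fy1 /subr0_eq y1E] [y2 Gy2 /subr0_eq y2E]] le] :=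
  h _ _ _ zl_d Hw eps'_gt0.
exists z', w'; split; first by exists l2; [rewrite -y1E|rewrite -y2E].
have : enorm (z' - z) + enorm (w' - 0) + enorm (l2 - l') <=
    kappa * (enorm (a - 0) + enorm (w - 0)) + eps' := le.
by rewrite !subr0; apply: le_trans; rewrite lerDl enorm_ge0.
Qed.

Lemma stationary_of_Hsplit :
  metrically_subregular (HM_map F G M) zb (0, 0) ->
  (forall l, K_map F G zb l ->
    metrically_subregular (Hsplit_map F G) (zb, 0, zb, l) (0, 0, 0)) ->
  explicitly_M_stationary f F G M zb.
Proof.
move=> HM_sub Hsplit; have [l Fl Gl] := zb_feasible.1.
have [kappa [d1 [kappa_gt0 d1_gt0 h]]] :=
  metrically_subregular_error_bound (Hsplit l (conj Fl Gl)).
have [C [d2 [C_ge0 d2_gt0 hC]]] := HM_error_bound kappa_gt0 HM_sub.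
have [c c_gt0 hc] := @enorm_bound R (Z * L * S)%type.
(* The residual consists of differences of two points near the same centre, hence the half; [c]
   converts to [enorm]. *)
pose del := Num.min d1 (Num.min d2 (d2 / c / 2)).
have del_gt0 : 0 < del by rewrite !lt_min d1_gt0 d2_gt0 !divr_gt0.
apply: (gph_stationary (conj Fl Gl) C_ge0 del_gt0).
move=> [z l1] [[q l2] w] x eps Fz Gq Mx.
rewrite !prod_normE /= !subr0 !gt_max.
move=> /andP[z_d l1_d] /andP[/andP[q_d l2_d] w_d] _.
have dist_lt (V : normedModType R) (b u v : V) :
    `|u - b| < del -> `|v - b| < del -> `|u - v| < d2 / c.
  rewrite -(subrKA b u (- v)) !lt_min => /and3P[_ _ u_d] /and3P[_ _ v_d].
  by rewrite (le_lt_trans (ler_normD _ _)) // (distrC b); move: u_d v_d; lra.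
have eE : enorm ((q, l2, w) - (z, l1, 0)) =
    enorm ((z - q, l1 - l2, w) : Z * L * S).
  have -> : enorm ((q, l2, w) - (z, l1, 0)) =
    enorm (q - z) + enorm (l2 - l1) + enorm (w - 0) by [].
  by rewrite subr0 (enormB q) (enormB l2).
rewrite /= eE; apply: hC => //.
- by move: z_d; rewrite !lt_min => /and3P[].
- exact: enorm_ge0.
- rewrite (le_lt_trans (hc _)) // mulrC -ltr_pdivlMr //.
  rewrite !prod_normE /= !gt_max (dist_lt _ zb) ?(dist_lt _ l) //=.
  by rewrite -[w]subr0 (dist_lt _ 0) // ?subr0 ?normr0.
move=> eps' eps'_gt0.
have zq_d : `|(z, 0 : S, q, l2) - (zb, 0, zb, l)| < d1.
  have lt1 t : t < del -> t < d1 by rewrite lt_min => /andP[].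
  by rewrite !prod_normE /= !gt_max subr0 normr0 !lt1.
(* The copy [q] lets [F] and [G] be evaluated at unrelated points, so any pair from the two graphs
   gives a value here, of [enorm] equal to that of [(q, l2, w) - (z, l1, 0)]. *)
have Hw : Hsplit_map F G (z, 0, q, l2) (z - q, l1 - l2, w).
  by split; [split=> //; exists l1|exists w; rewrite ?subr0].
have [[[[z' w'] q'] l3]] := h _ _ _ zq_d Hw eps'_gt0.
move=> [[/= zq'] [y1 Fy1 /subr0_eq y1E] [y2 Gy2 /subr0_eq y2E]] le.
have qE : q' = z' by apply/esym/subr0_eq.
exists z', w'; split; first by exists l3; [rewrite -y1E|rewrite -y2E -qE].
have : enorm (z' - z) + enorm (w' - 0) + enorm (q' - q) + enorm (l3 - l2) <=
    kappa * (enorm (z - q - 0) + enorm (l1 - l2 - 0) + enorm (w - 0)) + eps' := le.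
rewrite !subr0; apply: le_trans.
by rewrite -addrA lerDl addr_ge0 ?enorm_ge0.
Qed.

Lemma stationary_of_calHM (l : L) : K_map F G zb l ->
  metrically_subregular (calHM_map F G M) (zb, l) (0, 0, 0) ->
  coderivative_inclusion F G zb l ->
  explicitly_M_stationary f F G M zb.
Proof.
move=> Kl /metrically_subregular_error_bound[kappa [d [kappa_gt0 d_gt0 h]]] inc.
apply: (calH_stationary Kl inc (ltW kappa_gt0) d_gt0).
move=> [[z l'] [a w]] x eps Haw Mx.
rewrite prod_normE gt_max => /andP[zl_d _] _ eps_gt0.
have Hw : calHM_map F G M (z, l') (a, w, z - x) by split=> //; exists x.
have [[z' l2] [/= /calH_mapP[F2 G2] [x2 Mx2 /subr0_eq x2E]] le] :=
  h _ _ _ zl_d Hw eps_gt0.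
exists z'; first by split; [exists l2; rewrite // -[l2]addr0|rewrite x2E].
have : enorm (z' - z) + enorm (l2 - l') <=
  kappa * (enorm (a - 0) + enorm (w - 0) + enorm (z - x - 0)) + eps := le.
by rewrite !subr0; apply: le_trans; rewrite lerDl enorm_ge0.
Qed.

Lemma stationary_of_frakHM (l : L) : K_map F G zb l ->
  metrically_subregular (frakHM_map F G M) (zb, l) ((0, 0), (0, 0, 0), 0) ->
  explicitly_M_stationary f F G M zb.
Proof.
move=> Kl /metrically_subregular_error_bound[kappa [d [kappa_gt0 d_gt0 h]]].
apply: (gph_stationary Kl (ltW kappa_gt0) d_gt0).
move=> p q x eps Fp Gq Mx p_d _ _ eps_gt0.
(* Evaluating at the point [p] of [gph F] itself makes the first residual zero and leaves those of
   [gph G] and [M]. *)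
have Hw : frakHM_map F G M p (p - p, (p, 0) - q, p.1 - x).
  by split; [split; [exists p|exists q]|exists x].
have [p' [[[p2 Fp2 /subr0_eq p2E]
  [q2 Gq2 /subr0_eq q2E]]] [x2 Mx2 /subr0_eq x2E] le] :=
  h _ _ _ p_d Hw eps_gt0.
exists p'.1.
  split; last by rewrite x2E.
  exists p'.2; first by rewrite p2E.
  by move: Gq2; rewrite -q2E /gph /= -surjective_pairing.
have : enorm (p'.1 - p.1) + enorm (p'.2 - p.2) <=
  kappa * (enorm (p - p - 0) + enorm ((p, 0) - q - 0) + enorm (p.1 - x - 0)) + eps
  := le.
rewrite !subr0 subrr enorm0 add0r (enormB q).
by apply: le_trans; rewrite lerDl enorm_ge0.
Qed.

End stationarity.

Theorem theorem4p19 (R : realType) (n m s : nat)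
    (f : 'rV[R]_n -> R)
    (F : 'rV[R]_n -> set 'rV[R]_m)
    (G : 'rV[R]_n * 'rV[R]_m -> set 'rV[R]_s)
    (M : set 'rV[R]_n)
    (f_lip : locally_lipschitz f)
    (F_closed : closed (gph F))
    (G_closed : closed (gph G))
    (M_nonempty : M !=set0)
    (M_closed : closed M)
    (H_closed : locally_closed (gph (H_map F G)))
    (zb : 'rV[R]_n)
    (zb_min : local_minimizer f F G M zb) :
  (* (a) *)
  (metrically_subregular (HM_map F G M) zb (0, 0) ->
   inner_semicompact (Khat_map F G) (zb, 0) (svdom (Khat_map F G)) ->
   (forall l, K_map F G zb l ->
      metrically_subregular (calHhat_map F G) (zb, 0, l) (0, 0) /\
      coderivative_inclusion F G zb l) ->
   explicitly_M_stationary f F G M zb)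
  /\
  (* (b) *)
  (metrically_subregular (HM_map F G M) zb (0, 0) ->
   inner_semicompact (Kpair_map F G) (zb, 0) (svdom (Kpair_map F G)) ->
   (forall l, K_map F G zb l ->
      metrically_subregular (Hsplit_map F G) (zb, 0, zb, l) (0, 0, 0)) ->
   explicitly_M_stationary f F G M zb)
  /\
  (* (c) *)
  ((exists2 l, K_map F G zb l &
      metrically_subregular (calHM_map F G M) (zb, l) (0, 0, 0) /\
      coderivative_inclusion F G zb l) ->
   explicitly_M_stationary f F G M zb)
  /\
  (* (d) *)
  ((exists2 l, K_map F G zb l &
      metrically_subregular (frakHM_map F G M) (zb, l)
        ((0, 0), (0, 0, 0), 0)) ->
   explicitly_M_stationary f F G M zb).
Proof.
split; [|split; [|split]].
- by move=> HM_sub _; exact: stationary_of_calHhat.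
- by move=> HM_sub _; exact: stationary_of_Hsplit.
- by move=> [l Kl [HM_sub inc]]; exact: (stationary_of_calHM _ _ _ _ _ Kl).
- by move=> [l Kl HM_sub]; exact: (stationary_of_frakHM _ _ _ _ _ Kl).
Qed.
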